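(* Let $(A,\Delta,\diamond,\circ)$ be a Hopf truss over a field $\mathbb{K}$ with cocycle $\sigma$. If $(A,\Delta,\circ)$ is a Hopf algebra, then $A$ is a Hopf brace with respect to $\diamond$ and the operation $\bullet$ defined by $$a\bullet b = \sigma^{-1}(a)\circ b = a\circ 1_\diamond^\circ\circ b,\qquad\text{for all } a,b\in A$$ (in particular $\sigma$ is bijective, $1_\diamond$ is invertible in $(A,\circ)$, and the two expressions for $a\bullet b$ agree).
   Context: Sweedler notation $\Delta(a) = \sum a_{(1)}\otimes a_{(2)}$ is used. A (left) Hopf truss consists of a coalgebra $(A,\Delta,\varepsilon)$ over a field $\mathbb{K}$, a bilinear operation $\diamond$ making $(A,\Delta,\varepsilon)$ a Hopf algebra with identity $1_\diamond$ and antipode $S$, a bilinear operation $\circ$ making $(A,\Delta,\varepsilon)$ a non-unital bialgebra (i.e. $\circ:A\otimes A\to A$ is an associative morphism of coalgebras), and a coalgebra endomorphism $\sigma$ of $(A,\Delta,\varepsilon)$, called the cocycle, such that for all $a,b,c\in A$, $a\circ(b\diamond c) = \sum(a_{(1)}\circ b)\diamond S\sigma(a_{(2)})\diamond(a_{(3)}\circ c)$. A Hopf brace is a coalgebra $(A,\Delta,\varepsilon)$ with two bilinear operations $\diamond$ and $\bullet$, each making it a Hopf algebra, such that for all $a,b,c\in A$, $a\bullet(b\diamond c) = \sum(a_{(1)}\bullet b)\diamond S(a_{(2)})\diamond(a_{(3)}\bullet c)$, where $S$ is the antipode of $(A,\Delta,\diamond)$. $1_\diamond^\circ$ denotes the inverse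 of $1_\diamond$ in the unital algebra $(A,\circ)$. *)

(* Defs.v *)
From HB Require Import structures.
From mathcomp Require Import all_boot all_order all_algebra.
From mathcomp Require Import boolp.

Set Implicit Arguments.
Unset Strict Implicit.
Unset Printing Implicit Defensive.

Import GRing.Theory.
Local Open Scope ring_scope.
Local Open Scope quotient_scope.

(* Tensor product of two (possibly infinite-dimensional) vector spaces: formal
   finite sums of pure tensors, written as sequences of pairs, modulo the
   identification of two formal sums when no bilinear map into any vector space
   separates them.  The universal property is [tliftE], [tlift_linear] and
   [tensor_ext] below. *)
Section Tensor.
Variables (K : fieldType) (A B : lmodType K).
Implicit Types (s t : seq (A * B)).

Definition formal_eval (W : lmodType K) (f : A -> B -> W) s : W :=
  \sum_(p <- s) f p.1 p.2.

Definition tensor_equiv s t : bool :=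
  `[< forall (W : lmodType K) (f : A -> B -> W),
        bilinear_for *:%R *:%R f -> formal_eval f s = formal_eval f t >].

Lemma tensor_equivP s t :
  (forall (W : lmodType K) (f : A -> B -> W),
     bilinear_for *:%R *:%R f -> formal_eval f s = formal_eval f t) <->
  tensor_equiv s t.
Proof. by split=> [h|/asboolP //]; apply/asboolP. Qed.

Lemma tensor_equiv_refl : reflexive tensor_equiv.
Proof. by move=> s; apply/tensor_equivP. Qed.
Lemma tensor_equiv_sym : symmetric tensor_equiv.
Proof.
by move=> s t; apply/idP/idP => /tensor_equivP h; apply/tensor_equivP => W f bf;
  rewrite h.
Qed.
Lemma tensor_equiv_trans : transitive tensor_equiv.
Proof.
move=> t s u /tensor_equivP h1 /tensor_equivP h2; apply/tensor_equivP => W f bf.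
by rewrite h1 // h2.
Qed.

Canonical tensor_equiv_rel :=
  EquivRel tensor_equiv tensor_equiv_refl tensor_equiv_sym tensor_equiv_trans.

Definition tensor : Type := {eq_quot tensor_equiv}.
HB.instance Definition _ := Choice.on tensor.
HB.instance Definition _ := EqQuotient.on tensor.

Lemma pi_tensor_eq s t :
  (forall (W : lmodType K) (f : A -> B -> W),
     bilinear_for *:%R *:%R f -> formal_eval f s = formal_eval f t) ->
  \pi_tensor s = \pi_tensor t.
Proof. by move=> h; apply/eqmodP/tensor_equivP. Qed.

Lemma formal_eval_repr (W : lmodType K) (f : A -> B -> W) s :
  bilinear_for *:%R *:%R f ->
  formal_eval f (repr (\pi_tensor s)) = formal_eval f s.
Proof.
have /eqmodP/tensor_equivP h : \pi_tensor (repr (\pi_tensor s)) = \pi_tensor s.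
  by rewrite reprK.
exact: h.
Qed.

Lemma formal_eval_cat (W : lmodType K) (f : A -> B -> W) s t :
  formal_eval f (s ++ t) = formal_eval f s + formal_eval f t.
Proof. exact: big_cat. Qed.

Definition formal_scale (k : K) s := [seq (k *: p.1, p.2) | p <- s].

Lemma formal_eval_scale (W : lmodType K) (f : A -> B -> W) k s :
  bilinear_for *:%R *:%R f ->
  formal_eval f (formal_scale k s) = k *: formal_eval f s.
Proof.
move=> bf; rewrite /formal_eval big_map scaler_sumr; apply: eq_bigr => p _ /=.
exact: (scalable_linear (bf.1 p.2)).
Qed.

Definition tensor_zero : tensor := \pi_tensor [::].
Definition tensor_add (x y : tensor) : tensor := \pi_tensor (repr x ++ repr y).
Definition tensor_scale (k : K) (x : tensor) : tensor :=
  \pi_tensor (formal_scale k (repr x)).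
Definition tensor_opp (x : tensor) : tensor := tensor_scale (- 1) x.

Lemma tensor_eqP (x y : tensor) :
  (forall (W : lmodType K) (f : A -> B -> W),
     bilinear_for *:%R *:%R f ->
     formal_eval f (repr x) = formal_eval f (repr y)) -> x = y.
Proof. by move=> h; rewrite -[x]reprK -[y]reprK; apply: pi_tensor_eq. Qed.

Lemma eval_add (W : lmodType K) (f : A -> B -> W) x y :
  bilinear_for *:%R *:%R f ->
  formal_eval f (repr (tensor_add x y)) =
  formal_eval f (repr x) + formal_eval f (repr y).
Proof. by move=> bf; rewrite formal_eval_repr // formal_eval_cat. Qed.

Lemma eval_zero (W : lmodType K) (f : A -> B -> W) :
  bilinear_for *:%R *:%R f -> formal_eval f (repr tensor_zero) = 0.
Proof. by move=> bf; rewrite formal_eval_repr // /formal_eval big_nil. Qed.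

Lemma eval_scale (W : lmodType K) (f : A -> B -> W) k x :
  bilinear_for *:%R *:%R f ->
  formal_eval f (repr (tensor_scale k x)) = k *: formal_eval f (repr x).
Proof. by move=> bf; rewrite formal_eval_repr // formal_eval_scale. Qed.

Fact tensor_addA : associative tensor_add.
Proof. by move=> x y z; apply: tensor_eqP => W f bf; rewrite !eval_add ?addrA. Qed.
Fact tensor_addC : commutative tensor_add.
Proof. by move=> x y; apply: tensor_eqP => W f bf; rewrite !eval_add // addrC. Qed.
Fact tensor_add0 : left_id tensor_zero tensor_add.
Proof.
by move=> x; apply: tensor_eqP => W f bf; rewrite eval_add ?eval_zero ?add0r.
Qed.
Fact tensor_addN : left_inverse tensor_zero tensor_opp tensor_add.
Proof.
move=> x; apply: tensor_eqP => W f bf.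
by rewrite eval_add ?eval_zero ?eval_scale // scaleN1r addNr.
Qed.

HB.instance Definition _ := GRing.isZmodule.Build tensor
  tensor_addA tensor_addC tensor_add0 tensor_addN.

Fact tensor_scaleA k l x :
  tensor_scale k (tensor_scale l x) = tensor_scale (k * l) x.
Proof. by apply: tensor_eqP => W f bf; rewrite !eval_scale // scalerA. Qed.
Fact tensor_scale1 : left_id 1 tensor_scale.
Proof. by move=> x; apply: tensor_eqP => W f bf; rewrite eval_scale ?scale1r. Qed.
Fact tensor_scaleDr : right_distributive tensor_scale +%R.
Proof.
move=> k x y; apply: tensor_eqP => W f bf.
by rewrite eval_scale // !eval_add // !eval_scale // scalerDr.
Qed.
Fact tensor_scaleDl x : {morph tensor_scale^~ x : k l / k + l}.
Proof.
move=> k l; apply: tensor_eqP => W f bf.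
by rewrite eval_add // !eval_scale // scalerDl.
Qed.

HB.instance Definition _ := GRing.Zmodule_isLmodule.Build K tensor
  tensor_scaleA tensor_scale1 tensor_scaleDr tensor_scaleDl.

Definition tens (a : A) (b : B) : tensor := \pi_tensor [:: (a, b)].

(* [tlift f] is the linear map induced by [f]; it is only meaningful when [f]
   is bilinear, since otherwise it depends on the chosen representative. *)
Definition tlift (W : lmodType K) (f : A -> B -> W) (x : tensor) : W :=
  formal_eval f (repr x).

Lemma tliftE (W : lmodType K) (f : A -> B -> W) a b :
  bilinear_for *:%R *:%R f -> tlift f (tens a b) = f a b.
Proof.
by move=> bf; rewrite /tlift formal_eval_repr // /formal_eval big_seq1.
Qed.

Lemma tlift_linear (W : lmodType K) (f : A -> B -> W) :
  bilinear_for *:%R *:%R f -> linear (tlift f).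
Proof. by move=> bf k x y; rewrite /tlift eval_add // eval_scale. Qed.

Lemma tens_bilinear : bilinear_for *:%R *:%R tens.
Proof.
split=> u k x y /=; apply: tensor_eqP => W f bf.
  by rewrite eval_add // eval_scale // !formal_eval_repr // /formal_eval
     !big_seq1 /=; apply: (bf.1 u).
by rewrite eval_add // eval_scale // !formal_eval_repr // /formal_eval
   !big_seq1 /=; apply: (bf.2 u).
Qed.

Lemma tensor_sum (x : tensor) : x = \sum_(p <- repr x) tens p.1 p.2.
Proof.
apply: tensor_eqP => W f bf; elim: (repr x) => [|p s IHs].
  by rewrite big_nil eval_zero // /formal_eval big_nil.
rewrite big_cons eval_add // -IHs formal_eval_repr //.
by rewrite /formal_eval big_cons big_seq1.
Qed.

Lemma tensor_ext (W : lmodType K) (f g : tensor -> W) :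
  linear f -> linear g -> (forall a b, f (tens a b) = g (tens a b)) -> f =1 g.
Proof.
move=> lf lg h x; rewrite (tensor_sum x); elim: (repr x) => [|p s IHs].
  have z0 (k : tensor -> W) : linear k -> k 0 = 0.
    by move=> lk; rewrite -[0 in LHS](addNr 0) -scaleN1r lk scaleN1r addNr.
  by rewrite big_nil !z0.
by rewrite big_cons -[tens _ _]scale1r lf lg h IHs.
Qed.

End Tensor.

Arguments tens {K A B}.
Arguments tlift {K A B W}.
Notation "A ⊗ B" := (tensor A B) (at level 40, left associativity) : type_scope.
Notation "a ⊗ b" := (tens a b) (at level 40, left associativity) : ring_scope.

Section TensorMaps.
Variable K : fieldType.
Implicit Types A B C D : lmodType K.

Definition tmap A B C D (f : A -> C) (g : B -> D) : (A ⊗ B)%type -> (C ⊗ D)%type :=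
  tlift (fun a b => f a ⊗ g b).

Definition tassoc A B C : ((A ⊗ B) ⊗ C)%type -> (A ⊗ (B ⊗ C))%type :=
  tlift (fun x c => tlift (fun a b => a ⊗ (b ⊗ c)) x).

Definition tinterchange A B C D :
    ((A ⊗ B) ⊗ (C ⊗ D))%type -> ((A ⊗ C) ⊗ (B ⊗ D))%type :=
  tlift (fun x y => tlift (fun a b => tlift (fun c d => (a ⊗ c) ⊗ (b ⊗ d)) y) x).

End TensorMaps.

Section Coalgebra.
Variable K : fieldType.
Implicit Types A B C : lmodType K.

Record is_coalgebra A (Delta : A -> (A ⊗ A)%type) (eps : A -> K) : Prop := {
  comul_linear : linear Delta;
  counit_scalar : scalar eps;
  comulA : forall a, tassoc (tmap Delta id (Delta a)) = tmap id Delta (Delta a);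
  counitl : forall a, tlift (fun x y => eps x *: y) (Delta a) = a;
  counitr : forall a, tlift (fun x y => eps y *: x) (Delta a) = a
}.

Record is_coalgebra_morphism A B
    (DeltaA : A -> (A ⊗ A)%type) (epsA : A -> K)
    (DeltaB : B -> (B ⊗ B)%type) (epsB : B -> K) (f : A -> B) : Prop := {
  cmorph_linear : linear f;
  cmorph_comul : forall a, DeltaB (f a) = tmap f f (DeltaA a);
  cmorph_counit : forall a, epsB (f a) = epsA a
}.

Definition tcomul A B (DeltaA : A -> (A ⊗ A)%type) (DeltaB : B -> (B ⊗ B)%type)
    (x : (A ⊗ B)%type) : ((A ⊗ B) ⊗ (A ⊗ B))%type :=
  tinterchange (tmap DeltaA DeltaB x).

Definition tcounit A B (epsA : A -> K) (epsB : B -> K) (x : (A ⊗ B)%type) : K :=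
  tlift (fun a b => epsA a * epsB b : K^o) x.

(* [sweedler2 Delta F a] is the sum of the F a_(1) a_(2), for F bilinear;
   [sweedler3 Delta F a] is the sum of the F a_(1) a_(2) a_(3), for F
   trilinear. *)
Definition sweedler2 A B (Delta : A -> (A ⊗ A)%type) (F : A -> A -> B) (a : A) : B :=
  tlift F (Delta a).

Definition sweedler3 A B (Delta : A -> (A ⊗ A)%type) (F : A -> A -> A -> B)
    (a : A) : B :=
  sweedler2 Delta (fun x y => sweedler2 Delta (F x) y) a.

End Coalgebra.

Section HopfTruss.
Variables (K : fieldType) (A : lmodType K).
Variables (Delta : A -> (A ⊗ A)%type) (eps : A -> K).

Record is_nonunital_bialgebra (mul : A -> A -> A) : Prop := {
  nub_coalgebra : is_coalgebra Delta eps;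
  nub_bilinear : bilinear_for *:%R *:%R mul;
  nub_assoc : associative mul;
  nub_morph : is_coalgebra_morphism (tcomul Delta Delta) (tcounit eps eps)
                Delta eps (tlift mul)
}.

Record is_hopf_algebra (mul : A -> A -> A) (one : A) (S : A -> A) : Prop := {
  hopf_bialgebra : is_nonunital_bialgebra mul;
  hopf_mul1l : left_id one mul;
  hopf_mul1r : right_id one mul;
  hopf_comul1 : Delta one = one ⊗ one;
  hopf_counit1 : eps one = 1;
  hopf_antipode_linear : linear S;
  hopf_antipodel : forall a,
    sweedler2 Delta (fun a1 a2 => mul (S a1) a2) a = eps a *: one;
  hopf_antipoder : forall a,
    sweedler2 Delta (fun a1 a2 => mul a1 (S a2)) a = eps a *: one
}.

Record is_hopf_truss (dia : A -> A -> A) (one : A) (S : A -> A)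
    (circ : A -> A -> A) (sigma : A -> A) : Prop := {
  truss_hopf : is_hopf_algebra dia one S;
  truss_bialgebra : is_nonunital_bialgebra circ;
  truss_cocycle : is_coalgebra_morphism Delta eps Delta eps sigma;
  truss_compat : forall a b c,
    circ a (dia b c) =
    sweedler3 Delta (fun a1 a2 a3 =>
      dia (dia (circ a1 b) (S (sigma a2))) (circ a3 c)) a
}.

Record is_hopf_brace (dia : A -> A -> A) (one : A) (S : A -> A)
    (bul : A -> A -> A) (one' : A) (T : A -> A) : Prop := {
  brace_hopf : is_hopf_algebra dia one S;
  brace_hopf' : is_hopf_algebra bul one' T;
  brace_compat : forall a b c,
    bul a (dia b c) =
    sweedler3 Delta (fun a1 a2 a3 =>
      dia (dia (bul a1 b) (S a2)) (bul a3 c)) a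
}.

End HopfTruss.

(* Main.v *)
(* The truss axiom at [b = c = 1_⋄] reads [f = f * Sσ * f] in the convolution
   algebra [Hom(A, (A, ⋄))], where [f a = a ∘ 1_⋄].  Both [f] and [σ] are
   coalgebra maps, so they are convolution invertible with inverses [Sf] and
   [Sσ]; cancelling gives [f = σ].  Since [1_⋄] is grouplike it is invertible in
   the Hopf algebra [(A, ∘)], so [σ] is bijective and [a • b] is
   [σ (σ^-1 a ∘ σ^-1 b)]: the structure [•] is the transport of [∘] along the
   coalgebra automorphism [σ], and the brace axiom at [a] is the truss axiom at
   [σ^-1 a]. *)
Require Import Defs.
From mathcomp Require Import all_boot all_order all_algebra.
From mathcomp Require Import boolp.

Set Implicit Arguments.
Unset Strict Implicit.
Unset Printing Implicit Defensive.

Import GRing.Theory.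
Local Open Scope ring_scope.

Local Notation bilin f := (bilinear_for *:%R *:%R f).

(** * Linear and bilinear maps on tensor products *)

Section TensorCalculus.
Variable K : fieldType.
Implicit Types V W X Y Z : lmodType K.

(** Unfolds [bilinear_for], which speaks of linear partial applications, into two equations that
    serve as rewrite rules. *)
Lemma bilinP V W X (f : V -> W -> X) :
  bilin f <->
  (forall k x y u, f (k *: x + y) u = k *: f x u + f y u) /\
  (forall k x y u, f u (k *: x + y) = k *: f u x + f u y).
Proof.
split=> -[fl fr]; first by split=> k x y u; [apply: fl|apply: fr].
by split=> u k x y; [apply: fl|apply: fr].
Qed.

Arguments bilinP {V W X f}.

Lemma tensDl V W k (x y : V) (u : W) :
  (k *: x + y) ⊗ u = k *: (x ⊗ u) + y ⊗ u.
Proof. exact: (bilinP.1 (@tens_bilinear K V W)).1. Qed.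

Lemma tensDr V W k (x y : W) (u : V) :
  u ⊗ (k *: x + y) = k *: (u ⊗ x) + u ⊗ y.
Proof. exact: (bilinP.1 (@tens_bilinear K V W)).2. Qed.

Lemma lin0 V W (f : V -> W) : linear f -> f 0 = 0.
Proof.
by move=> lf; rewrite -[0 in LHS](addNr 0) -scaleN1r lf scaleN1r addNr.
Qed.

Lemma linZ V W (f : V -> W) : linear f -> forall k x, f (k *: x) = k *: f x.
Proof. by move=> lf k x; rewrite -[k *: x]addr0 lf (lin0 lf) addr0. Qed.

(** [tlift] is a finite sum over the representative [repr x], and [g] commutes with finite sums. *)
Lemma lin_tlift V W X Y (g : X -> Y) (f : V -> W -> X) x :
  linear g -> g (tlift f x) = tlift (fun a b => g (f a b)) x.
Proof.
move=> lg; rewrite /tlift /formal_eval; elim: (repr x) => [|p s IHs].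
  by rewrite !big_nil (lin0 lg).
by rewrite !big_cons -[f _ _]scale1r lg IHs !scale1r.
Qed.

Lemma eq_tlift V W X (f g : V -> W -> X) x :
  (forall a b, f a b = g a b) -> tlift f x = tlift g x.
Proof. by move=> fg; apply: eq_bigr => p _; rewrite fg. Qed.

Lemma tlift_comb V W X k (f g : V -> W -> X) x :
  tlift (fun a b => k *: f a b + g a b) x = k *: tlift f x + tlift g x.
Proof. by rewrite /tlift /formal_eval scaler_sumr -big_split. Qed.

Lemma lin_comp V W X (f : W -> X) (g : V -> W) :
  linear f -> linear g -> linear (fun x => f (g x)).
Proof. by move=> lf lg k x y; rewrite lg lf. Qed.

Lemma bilin_comp V W V' W' X (f : V -> W -> X) (g : V' -> V) (h : W' -> W) :
  bilin f -> linear g -> linear h -> bilin (fun a b => f (g a) (h b)).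
Proof.
by move=> /bilinP[fl fr] lg lh; apply/bilinP; split=> k x y u;
  rewrite ?lg ?lh ?fl ?fr.
Qed.

Lemma lin_bilin V W X Y (g : X -> Y) (f : V -> W -> X) :
  linear g -> bilin f -> bilin (fun a b => g (f a b)).
Proof.
by move=> lg /bilinP[fl fr]; apply/bilinP; split=> k x y u; rewrite ?fl ?fr lg.
Qed.

Lemma tmap_bilin V W X Y (f : V -> X) (g : W -> Y) :
  linear f -> linear g -> bilin (fun a b => f a ⊗ g b).
Proof. by move=> lf lg; apply: bilin_comp => //; apply: tens_bilinear. Qed.

Lemma tmap_linear V W X Y (f : V -> X) (g : W -> Y) :
  linear f -> linear g -> linear (tmap f g).
Proof. by move=> lf lg; apply: tlift_linear; apply: tmap_bilin. Qed.

Lemma tmapE V W X Y (f : V -> X) (g : W -> Y) a b :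
  linear f -> linear g -> tmap f g (a ⊗ b) = f a ⊗ g b.
Proof. by move=> lf lg; rewrite /tmap tliftE //; apply: tmap_bilin. Qed.

Lemma tlift_tmap V W X Y Z (F : X -> Y -> Z) (f : V -> X) (g : W -> Y) x :
  bilin F -> tlift F (tmap f g x) = tlift (fun a b => F (f a) (g b)) x.
Proof.
move=> bF; rewrite /tmap lin_tlift; last exact: tlift_linear.
by apply: eq_tlift => a b; rewrite tliftE.
Qed.

Lemma tmap_can V W (f : V -> W) (g : W -> V) :
  linear f -> linear g -> cancel f g -> cancel (tmap f f) (tmap g g).
Proof.
move=> lf lg fK x; rewrite -[RHS]/(id x); move: x; apply: tensor_ext.
- exact: lin_comp (tmap_linear _ _) (tmap_linear _ _).
- by [].
- by move=> a b; rewrite !tmapE // !fK.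
Qed.

(** Since [tlift] has its meaning on bilinear maps, this is the well-definedness of
    [tinterchange]. *)
Lemma tinterchange_bilin V W X Y :
  bilin (fun (x : tensor V W) (y : tensor X Y) =>
    tlift (fun a b => tlift (fun c d => (a ⊗ c) ⊗ (b ⊗ d)) y) x).
Proof.
have b2 a b : bilin (fun (c : X) (d : Y) => ((a : V) ⊗ c) ⊗ ((b : W) ⊗ d)).
  by apply/bilinP; split=> k x y u; rewrite !tensDr ?tensDl.
apply/bilinP; split=> k x y u.
  apply: tlift_linear; apply/bilinP; split=> l a b c;
    by rewrite -tlift_comb; apply: eq_tlift => d e; rewrite !tensDl ?tensDr.
by rewrite -tlift_comb; apply: eq_tlift => a b; apply: tlift_linear.
Qed.

Lemma tinterchange_tens V W X Y (x : tensor V W) (y : tensor X Y) :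
  tinterchange (x ⊗ y) =
  tlift (fun a b => tlift (fun c d => (a ⊗ c) ⊗ (b ⊗ d)) y) x.
Proof. by rewrite /tinterchange tliftE //; apply: tinterchange_bilin. Qed.

Lemma tinterchange_linear V W X Y : linear (@tinterchange K V W X Y).
Proof. by apply: tlift_linear; apply: tinterchange_bilin. Qed.

Lemma tinterchange_nat V V' W W' X X' Y Y' (f : V -> V') (g : W -> W')
    (h : X -> X') (l : Y -> Y') x y :
  linear f -> linear g -> linear h -> linear l ->
  tinterchange (tmap f g x ⊗ tmap h l y) =
  tmap (tmap f h) (tmap g l) (tinterchange (x ⊗ y)).
Proof.
move=> lf lg lh ll; have lm : linear (tmap (tmap f h) (tmap g l)).
  by apply: tmap_linear; apply: tmap_linear.
rewrite !tinterchange_tens lin_tlift //.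
rewrite tlift_tmap.
  apply: eq_tlift => a b; rewrite lin_tlift //.
  rewrite tlift_tmap.
    apply: eq_tlift => c d.
    by rewrite tmapE ?(tmapE, tmap_linear) //; apply: tmap_linear.
  by apply/bilinP; split=> k z t u; rewrite !tensDr ?tensDl.
apply/bilinP; split=> k z t u;
  by rewrite -tlift_comb; apply: eq_tlift => c d; rewrite !tensDl ?tensDr.
Qed.

End TensorCalculus.

Arguments bilinP {K V W X f}.

(** * Coalgebra morphisms: composites, inverses, tensor products *)

Section CoalgebraCalculus.
Variable K : fieldType.
Implicit Types A B C V W : lmodType K.

Lemma cmorph_comp A B C (DA : A -> tensor A A) eA (DB : B -> tensor B B) eB
    (DC : C -> tensor C C) eC (f : B -> C) (g : A -> B) :
  is_coalgebra_morphism DB eB DC eC f -> is_coalgebra_morphism DA eA DB eB g ->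
  is_coalgebra_morphism DA eA DC eC (fun x => f (g x)).
Proof.
move=> [lf Df ef] [lg Dg eg]; split=> [|a|a]; first exact: lin_comp.
  rewrite Df Dg /tmap lin_tlift; last exact/tlift_linear/tmap_bilin.
  by apply: eq_tlift => x y; rewrite tliftE //; apply: tmap_bilin.
by rewrite ef eg.
Qed.

(** Writing [b] as [f (g b)] turns [DB b] into [tmap f f (DA (g b))], and [tmap g g] undoes
    [tmap f f]. *)
Lemma cmorph_can A B (DA : A -> tensor A A) eA (DB : B -> tensor B B) eB
    (f : A -> B) (g : B -> A) :
  is_coalgebra_morphism DA eA DB eB f -> linear g ->
  cancel f g -> cancel g f -> is_coalgebra_morphism DB eB DA eA g.
Proof.
move=> [lf Df ef] lg fK gK; split=> // b.
  by rewrite -[in RHS](gK b) Df tmap_can.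
by rewrite -ef gK.
Qed.

Lemma scalar_mul_bilin A B (f : A -> K) (g : B -> K) :
  scalar f -> scalar g -> bilin (fun a b => f a * g b : K^o).
Proof.
move=> lf lg; apply/bilinP; split=> k x y u.
  by rewrite lf mulrDl -mulrA.
by rewrite lg mulrDr mulrCA.
Qed.

(** Compatibility with the comultiplications comes down, on pure tensors, to naturality of the
    interchange map. [hopf_transport] needs this for the factor [tmap g g]. *)
Lemma cmorph_tmap A B A' B' (DA : A -> tensor A A) eA (DB : B -> tensor B B) eB
    (DA' : A' -> tensor A' A') eA' (DB' : B' -> tensor B' B') eB'
    (f : A -> A') (g : B -> B') :
  linear DA -> linear DB -> linear DA' -> linear DB' ->
  scalar eA -> scalar eB -> scalar eA' -> scalar eB' ->
  is_coalgebra_morphism DA eA DA' eA' f ->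
  is_coalgebra_morphism DB eB DB' eB' g ->
  is_coalgebra_morphism (tcomul DA DB) (tcounit eA eB)
    (tcomul DA' DB') (tcounit eA' eB') (tmap f g).
Proof.
move=> lDA lDB lDA' lDB' leA leB leA' leB' [lf Df ef] [lg Dg eg].
split; first exact: tmap_linear.
- apply: tensor_ext => [||a b].
  + apply: lin_comp; last exact: tmap_linear.
    exact: lin_comp (@tinterchange_linear _ _ _ _ _) (tmap_linear _ _).
  + apply: lin_comp; first by apply: tmap_linear; apply: tmap_linear.
    exact: lin_comp (@tinterchange_linear _ _ _ _ _) (tmap_linear _ _).
  by rewrite /tcomul !tmapE // Df Dg tinterchange_nat.
- move=> x; rewrite /tcounit tlift_tmap.
    by apply: (@eq_tlift K A B (K^o : lmodType K)) => a b; rewrite ef eg.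
  exact: scalar_mul_bilin.
Qed.

(** * Sweedler sums over a fixed coalgebra *)

Section OneCoalgebra.
Variables (A : lmodType K) (Delta : A -> tensor A A) (eps : A -> K).
Hypothesis coA : is_coalgebra Delta eps.

Let lD : linear Delta := comul_linear coA.

Lemma eq_sweedler2 V (F G : A -> A -> V) a :
  (forall x y, F x y = G x y) -> sweedler2 Delta F a = sweedler2 Delta G a.
Proof. exact: eq_tlift. Qed.

Lemma sweedler2_linear V (F : A -> A -> V) :
  bilin F -> linear (sweedler2 Delta F).
Proof. by move=> bF; apply: lin_comp => //; apply: tlift_linear. Qed.

Lemma sweedler2_comb V k (F G : A -> A -> V) a :
  sweedler2 Delta (fun x y => k *: F x y + G x y) a =
  k *: sweedler2 Delta F a + sweedler2 Delta G a.
Proof. exact: tlift_comb. Qed.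

Lemma lin_sweedler2 V W (g : V -> W) (F : A -> A -> V) a :
  linear g ->
  g (sweedler2 Delta F a) = sweedler2 Delta (fun x y => g (F x y)) a.
Proof. exact: lin_tlift. Qed.

Lemma sweedler2_cmorph V (F : A -> A -> V) (g : A -> A) a :
  bilin F -> is_coalgebra_morphism Delta eps Delta eps g ->
  sweedler2 Delta F (g a) = sweedler2 Delta (fun x y => F (g x) (g y)) a.
Proof. by move=> bF [lg Dg _]; rewrite /sweedler2 Dg tlift_tmap. Qed.

Definition trilin V (F : A -> A -> A -> V) : Prop :=
  [/\ forall y z, linear (fun x => F x y z),
      forall x z, linear (fun y => F x y z)
    & forall x y, linear (fun z => F x y z)].

Lemma trilin_bilin V (F : A -> A -> A -> V) x : trilin F -> bilin (F x).
Proof. by case=> _ h2 h3; apply/bilinP; split=> *; [apply: h2|apply: h3]. Qed.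

(** Makes the outer sum in [sweedler3] a [tlift] of a bilinear map. *)
Lemma sweedler3_inner_bilin V (F : A -> A -> A -> V) :
  trilin F -> bilin (fun x y => sweedler2 Delta (F x) y).
Proof.
move=> tF; apply/bilinP; split=> k x y u.
  by rewrite -sweedler2_comb; apply: eq_sweedler2 => p q; case: tF => ->.
by apply: sweedler2_linear; apply: trilin_bilin.
Qed.

Lemma sweedler3_cmorph V (F : A -> A -> A -> V) (g : A -> A) a :
  trilin F -> is_coalgebra_morphism Delta eps Delta eps g ->
  sweedler3 Delta F (g a) = sweedler3 Delta (fun x y z => F (g x) (g y) (g z)) a.
Proof.
move=> tF mg; rewrite /sweedler3 (sweedler2_cmorph _ _ mg) //; last first.
  exact: sweedler3_inner_bilin.
by apply: eq_sweedler2 => x y; apply: sweedler2_cmorph => //; apply: trilin_bilin.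
Qed.

(** [sweedler3] splits the second leg again, while the right-hand side splits the first. The two are
    linked by applying to [comulA] the linear map that sends [p ⊗ t] to [tlift (F p) t]. *)
Lemma sweedler3_assoc V (F : A -> A -> A -> V) a : trilin F ->
  sweedler3 Delta F a =
  sweedler2 Delta (fun x z => sweedler2 Delta (fun p q => F p q z) x) a.
Proof.
move=> tF; have [h1 h2 h3] := tF.
have bG : bilin (fun (p : A) (t : tensor A A) => tlift (F p) t).
  apply/bilinP; split=> k x y u.
    by rewrite -tlift_comb; apply: eq_tlift => p q; rewrite h1.
  by apply: tlift_linear; apply: trilin_bilin.
have bH z : bilin (fun p q => F p q z).
  by apply/bilinP; split=> k x y u; [apply: h1|apply: h2].
have bT z : bilin (fun p q : A => p ⊗ (q ⊗ (z : A))).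
  by apply/bilinP; split=> k x y u; rewrite ?tensDl ?tensDr.
have /(congr1 (tlift (fun p t => tlift (F p) t))) := comulA coA a.
rewrite tlift_tmap // /sweedler3 /sweedler2 => <-.
rewrite /tassoc tlift_tmap; last first.
  apply/bilinP; split=> k x y u; first by apply: tlift_linear.
  by rewrite -tlift_comb; apply: eq_tlift => p q; rewrite !tensDr.
rewrite lin_tlift; last exact: tlift_linear.
apply: eq_tlift => x z; rewrite lin_tlift; last exact: tlift_linear.
by apply: eq_tlift => p q; rewrite tliftE // tliftE //; apply: trilin_bilin.
Qed.

End OneCoalgebra.

(** * The convolution algebra of a Hopf algebra, and transport of structure *)

Section Convolution.
Variables (A : lmodType K) (Delta : A -> tensor A A) (eps : A -> K).
Variables (mul : A -> A -> A) (one : A) (S : A -> A).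
Hypothesis H : is_hopf_algebra Delta eps mul one S.

Let nub := hopf_bialgebra H.
Let coA := nub_coalgebra nub.
Let bm := nub_bilinear nub.

Definition conv (f g : A -> A) (a : A) : A :=
  sweedler2 Delta (fun x y => mul (f x) (g y)) a.

Lemma trilin_mul3 (f g h : A -> A) : linear f -> linear g -> linear h ->
  trilin (fun x y z => mul (mul (f x) (g y)) (h z)).
Proof.
have [ml mr] := bilinP.1 bm.
by move=> lf lg lh; split=> p q k x y /=; rewrite ?lf ?lg ?lh !(ml, mr).
Qed.

(** Associativity of [mul] brings both sides to the same trilinear integrand, and coassociativity
    matches the two ways of splitting [a]. *)
Lemma convA (f g h : A -> A) : linear f -> linear g -> linear h ->
  conv f (conv g h) = conv (conv f g) h.
Proof.
have [ml mr] := bilinP.1 bm.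
move=> lf lg lh; apply/funext => a.
have := sweedler3_assoc coA a (trilin_mul3 lf lg lh).
rewrite /sweedler3 /conv => E.
transitivity (sweedler2 Delta (fun x y => sweedler2 Delta
   (fun p q => mul (mul (f x) (g p)) (h q)) y) a).
  apply: eq_sweedler2 => x y;
    rewrite lin_sweedler2; last by move=> k u v; apply: mr.
  by apply: eq_sweedler2 => p q; rewrite (nub_assoc nub).
rewrite E; apply: eq_sweedler2 => x y.
rewrite [RHS](@lin_sweedler2 _ _ _ _ (fun t => mul t (h y))) //.
by move=> k u v; apply: ml.
Qed.

Lemma conv_linear (f g : A -> A) : linear f -> linear g -> linear (conv f g).
Proof. by move=> lf lg; exact: (sweedler2_linear coA (bilin_comp bm lf lg)). Qed.

Lemma conv1l (f : A -> A) : linear f -> conv (fun a => eps a *: one) f = f.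
Proof.
have [ml mr] := bilinP.1 bm.
move=> lf; apply/funext => a; rewrite /conv -[in RHS](counitl coA a) lin_tlift //.
apply: eq_tlift => x y; rewrite (@linZ _ _ _ (fun t => mul t (f y))).
  by rewrite (hopf_mul1l H) linZ.
by move=> k u v; apply: ml.
Qed.

Lemma conv1r (f : A -> A) : linear f -> conv f (fun a => eps a *: one) = f.
Proof.
have [ml mr] := bilinP.1 bm.
move=> lf; apply/funext => a; rewrite /conv -[in RHS](counitr coA a) lin_tlift //.
apply: eq_tlift => x y; rewrite (@linZ _ _ _ (fun t => mul (f x) t)).
  by rewrite (hopf_mul1r H) linZ.
by move=> k u v; apply: mr.
Qed.

(** This is the antipode axiom at [f a]: a coalgebra map preserves [eps], and the Sweedler legs of
    [f a] are the images of those of [a]. *)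
Lemma conv_antipodel (f : A -> A) : is_coalgebra_morphism Delta eps Delta eps f ->
  conv (fun a => S (f a)) f = (fun a => eps a *: one).
Proof.
move=> mf; apply/funext => a; rewrite -(cmorph_counit mf) -(hopf_antipodel H).
rewrite (sweedler2_cmorph _ _ mf) //.
exact: bilin_comp bm (hopf_antipode_linear H) _.
Qed.

Lemma conv_antipoder (f : A -> A) : is_coalgebra_morphism Delta eps Delta eps f ->
  conv f (fun a => S (f a)) = (fun a => eps a *: one).
Proof.
move=> mf; apply/funext => a; rewrite -(cmorph_counit mf) -(hopf_antipoder H).
rewrite (sweedler2_cmorph _ _ mf) //.
exact: bilin_comp bm _ (hopf_antipode_linear H).
Qed.

Lemma hopf_transport (f g : A -> A) :
  is_coalgebra_morphism Delta eps Delta eps f ->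
  is_coalgebra_morphism Delta eps Delta eps g ->
  cancel f g -> cancel g f ->
  is_hopf_algebra Delta eps (fun a b => f (mul (g a) (g b))) (f one)
    (fun a => f (S (g a))).
Proof.
move=> mf mg fK gK.
have lf := cmorph_linear mf; have lg := cmorph_linear mg.
have lD := comul_linear coA; have le := counit_scalar coA.
have lS := hopf_antipode_linear H.
have bm' : bilin (fun a b => f (mul (g a) (g b))).
  by apply: lin_bilin => //; apply: bilin_comp.
split.
- split=> //.
    by move=> a b c; rewrite !fK (nub_assoc nub).
  (* The transported product is a composite of three coalgebra morphisms: [tmap g g], then
     [tlift mul], then [f]. *)
  have -> : tlift (fun a b => f (mul (g a) (g b)))
          = (fun x => f (tlift mul (tmap g g x))).
    by apply/funext => x; rewrite tlift_tmap // lin_tlift.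
  apply: cmorph_comp mf _; apply: cmorph_comp (nub_morph nub) _.
  exact: cmorph_tmap.
- by move=> a; rewrite fK (hopf_mul1l H) gK.
- by move=> a; rewrite fK (hopf_mul1r H) gK.
- by rewrite (cmorph_comul mf) (hopf_comul1 H) tmapE.
- by rewrite (cmorph_counit mf) (hopf_counit1 H).
- by apply: lin_comp => //; apply: lin_comp.
(* The right-hand side becomes [f (eps (g a) *: one)], that is, [f] applied to the original antipode
   axiom at [g a]. *)
- move=> a; rewrite -(cmorph_counit mg a) -linZ // -(hopf_antipodel H).
  rewrite (sweedler2_cmorph _ _ mg) // ?lin_sweedler2 //; last exact: bilin_comp.
  by apply: eq_sweedler2 => x y; rewrite fK.
- move=> a; rewrite -(cmorph_counit mg a) -linZ // -(hopf_antipoder H).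
  rewrite (sweedler2_cmorph _ _ mg) // ?lin_sweedler2 //; last exact: bilin_comp.
  by apply: eq_sweedler2 => x y; rewrite fK.
Qed.

End Convolution.

(** * Right multiplication by a grouplike element, and the form of the cocycle *)

Lemma cmorph_mulr A (Delta : A -> tensor A A) (eps : A -> K)
    (mul : A -> A -> A) (u : A) :
  is_nonunital_bialgebra Delta eps mul -> Delta u = u ⊗ u -> eps u = 1 ->
  is_coalgebra_morphism Delta eps Delta eps (fun a => mul a u).
Proof.
move=> nub Du eu.
have coA := nub_coalgebra nub; have mm := nub_morph nub.
have bm := nub_bilinear nub; have [ml mr] := bilinP.1 bm.
have lm := tlift_linear bm.
have lD := comul_linear coA; have le := counit_scalar coA.
have lu : linear (fun a => mul a u) by move=> k x y; apply: ml.
(* Seen as [tlift mul (a ⊗ u)], the product falls under [nub_morph]; as [u] is grouplike, only the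
   legs of [a] remain to be summed. *)
split=> // a; rewrite -(tliftE a u bm).
  rewrite (cmorph_comul mm) /tcomul tmapE // Du.
  rewrite tinterchange_tens lin_tlift; last exact: tmap_linear.
  apply: eq_tlift => x y; rewrite tliftE; first by rewrite tmapE // !tliftE.
  by apply/bilinP; split=> k p q z; rewrite !tensDr ?tensDl.
rewrite (cmorph_counit mm) /tcounit tliftE ?eu ?mulr1 //.
exact: scalar_mul_bilin.
Qed.

Lemma truss_cocycleE A (Delta : A -> tensor A A) (eps : A -> K)
    (dia : A -> A -> A) (one : A) (S : A -> A) (circ : A -> A -> A)
    (sigma : A -> A) :
  is_hopf_truss Delta eps dia one S circ sigma ->
  sigma = (fun a => circ a one).
Proof.
move=> [H nub ms compat]; set f := fun a => _.
have mf : is_coalgebra_morphism Delta eps Delta eps f.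
  exact: cmorph_mulr nub (hopf_comul1 H) (hopf_counit1 H).
have lf := cmorph_linear mf; have ls := cmorph_linear ms.
have lS := hopf_antipode_linear H.
have lSf := lin_comp lS lf; have lSs := lin_comp lS ls.
set Sf := (fun a => S (f a)) in lSf; set Ss := (fun a => S (sigma a)) in lSs.
pose cv := conv Delta dia.
(* The truss axiom at [b = c = one], where [one] is first expanded to [dia one one]; the product is
   then reassociated to the right. *)
have Ef : cv f (cv Ss f) = f.
  apply/funext => a; rewrite [RHS]/f -[one in RHS](hopf_mul1l H) compat.
  apply: eq_sweedler2 => x y; rewrite lin_sweedler2.
    apply: eq_sweedler2 => p q; exact: (nub_assoc (hopf_bialgebra H)).
  have [_ mr] := bilinP.1 (nub_bilinear (hopf_bialgebra H)).
  by move=> k u v; apply: mr.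
have l2 : linear (cv Ss f) by apply: (conv_linear H).
(* Multiplying [Ef] on the left by [Sf] cancels the leading [f]. *)
have E1 : cv Ss f = (fun a => eps a *: one).
  rewrite -[LHS](conv1l H) // -(conv_antipodel H mf) -(convA H) //.
  by congr (conv _ _ _ _).
(* In convolution notation, [sigma = sigma * (Ss * f) = (sigma * Ss) * f = f]. *)
by rewrite -[LHS](conv1r H) // -E1 (convA H) // (conv_antipoder H ms) (conv1l H).
Qed.

End CoalgebraCalculus.

Theorem lemma6p10 (K : fieldType) (A : lmodType K)
    (Delta : A -> tensor A A) (eps : A -> K)
    (dia : A -> A -> A) (oned : A) (S : A -> A)
    (circ : A -> A -> A) (sigma : A -> A)
    (onec : A) (T : A -> A)
    (truss : is_hopf_truss Delta eps dia oned S circ sigma)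
    (hopf : is_hopf_algebra Delta eps circ onec T) :
  exists (sigmainv : A -> A) (v : A),
    [/\ cancel sigma sigmainv /\ cancel sigmainv sigma,
        circ oned v = onec /\ circ v oned = onec,
        forall a b : A, circ (sigmainv a) b = circ (circ a v) b
      & exists (oneb : A) (Sb : A -> A),
          is_hopf_brace Delta eps dia oned S
            (fun a b : A => circ (sigmainv a) b) oneb Sb].
Proof.
have sE := truss_cocycleE truss.
have [H nub ms compat] := truss.
have coA := nub_coalgebra nub.
have bc := nub_bilinear nub; have [cl _] := bilinP.1 bc.
have bd := nub_bilinear (hopf_bialgebra H); have [dl dr] := bilinP.1 bd.
have cA := nub_assoc nub.
have lT := hopf_antipode_linear hopf; have lS := hopf_antipode_linear H.
(* The antipode of a grouplike element is its inverse, and [oned] is grouplike by [hopf_comul1 H]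
   and [hopf_counit1 H]. As [sigma] is right [circ]-multiplication by [oned], right multiplication
   by [v] inverts it. *)
pose v := T oned; pose sigmainv a := circ a v.
have uv : circ oned v = onec.
  have := hopf_antipoder hopf oned.
  rewrite (hopf_counit1 H) scale1r /sweedler2 (hopf_comul1 H) tliftE //.
  by apply: (bilin_comp bc).
have vu : circ v oned = onec.
  have := hopf_antipodel hopf oned.
  rewrite (hopf_counit1 H) scale1r /sweedler2 (hopf_comul1 H) tliftE //.
  by apply: (bilin_comp bc).
have sK : cancel sigma sigmainv.
  by move=> a; rewrite sE /sigmainv -cA uv (hopf_mul1r hopf).
have siK : cancel sigmainv sigma.
  by move=> a; rewrite sE /sigmainv -cA vu (hopf_mul1r hopf).
have ls := cmorph_linear ms.
have mi : is_coalgebra_morphism Delta eps Delta eps sigmainv.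
  by apply: cmorph_can ms _ sK siK => k x y; apply: cl.
exists sigmainv, v; split=> //.
(* Unit and antipode are those of [circ], transported along [sigma]. By [sE] this unit is
   [circ onec oned], hence [oned] itself. *)
exists (sigma onec), (fun a => sigma (T (sigmainv a))); split=> //.
  (* On the right, [sigmainv b] contributes a trailing [v] and the outer [sigma] a trailing [oned];
     they cancel by [vu]. *)
  have -> : (fun a b => circ (sigmainv a) b)
          = (fun a b => sigma (circ (sigmainv a) (sigmainv b))).
    apply/funext => a; apply/funext => b.
    by rewrite sE /sigmainv -!cA vu (hopf_mul1r hopf).
  exact: (hopf_transport hopf ms mi sK siK).
(* The truss axiom at [sigmainv a], with the sum rewritten over the legs of [a]; the middle factor
   [S (sigma (sigmainv a2))] is then [S a2]. *)
move=> a b c; rewrite compat (sweedler3_cmorph coA _ _ mi) //.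
  by apply: eq_sweedler2 => x y; apply: eq_sweedler2 => p q; rewrite siK.
by split=> p q k x y /=; rewrite ?ls ?lS ?cl ?dl ?dr.
Qed.
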